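(* Let $n$ be a positive integer. The lattices $\mathrm{WO}(\mathrm{Tot})$ and $\mathrm{WO}(\mathrm{TTot}_n)$ are completely semidistributive.
   Context: $\mathrm{Tot}$ is the set of all (strict) total orders $\prec$ on $\mathbb{Z}$; $<$ always denotes the usual order. An inversion of $\prec$ is a pair $(a,b)$ of integers with $a<b$ and $b\prec a$; $N(\prec)$ is the set of inversions. $\mathrm{WO}(\mathrm{Tot})$ is $\mathrm{Tot}$ partially ordered by $(\prec_1)\le(\prec_2)$ iff $N(\prec_1)\subseteq N(\prec_2)$. $\mathrm{TTot}_n\subseteq \mathrm{Tot}$ is the set of total orders $\prec$ (called TITOs) such that for all $a,b$: $a\prec b$ iff $a+n\prec b+n$; $\mathrm{WO}(\mathrm{TTot}_n)$ is $\mathrm{TTot}_n$ with the order induced from $\mathrm{WO}(\mathrm{Tot})$. Both posets are complete lattices. A complete lattice $L$ is completely semidistributive if for all $y,z\in L$ and every nonempty (possibly infinite) $X\subseteq L$: if $x\vee y=z$ for all $x\in X$ then $(\bigwedge X)\vee y=z$; and if $x\wedge y=z$ for all $x\in X$ then $(\bigvee X)\wedge y=z$. *)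

(* Defs.v *)
From HB Require Import structures.
From mathcomp Require Import all_boot all_order ssralg ssrnum ssrint.
From mathcomp Require Import boolp classical_sets.

Set Implicit Arguments.
Unset Strict Implicit.
Unset Printing Implicit Defensive.

Import Order.TTheory GRing.Theory Num.Theory.

Local Open Scope classical_set_scope.
Local Open Scope ring_scope.

(* Joins and meets are relational: [supremums [set x; y] z] means x \/ y = z,
   [infimums X m] means /\ X = m (suprema and infima are unique in a poset).
   Since completeness is a conjunct, they always exist. *)
Definition complete_lattice d (L : porderType d) : Prop :=
  forall X : set L, supremums X !=set0 /\ infimums X !=set0.

Definition completely_semidistributive d (L : porderType d) : Prop :=
  complete_lattice L /\
  forall (y z : L) (X : set L), X !=set0 ->
    ((forall x, X x -> supremums [set x; y] z) ->
       forall m, infimums X m -> supremums [set m; y] z) /\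
    ((forall x, X x -> infimums [set x; y] z) ->
       forall s, supremums X s -> infimums [set s; y] z).

(* Strict total orders on the integers; [prec r a b] is "a precedes b". *)
Record Tot := MkTot {
  prec :> rel int;
  prec_irr : irreflexive prec;
  prec_trans : transitive prec;
  prec_total : forall a b : int, a != b -> prec a b || prec b a
}.

HB.instance Definition _ := gen_eqMixin Tot.
HB.instance Definition _ := gen_choiceMixin Tot.

Definition inversions (r : Tot) : set (int * int) :=
  [set p | p.1 < p.2 /\ r p.2 p.1].

Definition le_WO (r s : Tot) : bool := `[< inversions r `<=` inversions s >].

Lemma Tot_eq (r s : Tot) : r =2 s -> r = s.
Proof.
case: r s => [r r1 r2 r3] [s s1 s2 s3] /= rs.
have E : r = s by apply/funext => a; apply/funext => b.
by subst s; congr MkTot; apply: Prop_irrelevance.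
Qed.

Lemma prec_asym (r : Tot) (a b : int) : a != b -> r a b = ~~ r b a.
Proof.
move=> ab; apply/idP/idP => [rab|].
  by apply/negP => /(prec_trans rab); rewrite prec_irr.
by have := prec_total r ab; case: (r b a); rewrite ?orbT ?orbF.
Qed.

Fact le_WO_refl : reflexive le_WO.
Proof. by move=> r; apply/asboolP. Qed.

Fact le_WO_trans : transitive le_WO.
Proof.
by move=> s r t /asboolP rs /asboolP st; apply/asboolP; apply: subset_trans st.
Qed.

Fact le_WO_anti : antisymmetric le_WO.
Proof.
move=> r s /andP[/asboolP rs /asboolP sr].
have inv (a b : int) : a < b -> r b a = s b a.
  move=> ab; apply/idP/idP => h.
    by have [] : inversions s (a, b) by apply: rs.
  by have [] : inversions r (a, b) by apply: sr.
apply: Tot_eq => a b; have [ab|ba|->] := ltgtP a b.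
- by rewrite !(@prec_asym _ a b) ?lt_eqF// inv.
- exact: inv.
- by rewrite !prec_irr.
Qed.

Fact WO_display : Order.disp_t. Proof. exact: Order.Disp tt tt. Qed.

(* [Tot], as a porderType, is the poset WO(Tot). *)
HB.instance Definition _ := Order.Le_isPOrder.Build WO_display Tot
  le_WO_refl le_WO_anti le_WO_trans.

Definition translation_invariant (n : nat) (r : Tot) : Prop :=
  forall a b : int, r a b <-> r (a + n%:Z) (b + n%:Z).

(* [TTot n], as a porderType, is the poset WO(TTot_n), with the order induced
   from WO(Tot); its suprema and infima are taken among TITOs only. *)
Record TTot (n : nat) := MkTTot {
  Tot_of_TTot :> Tot;
  _ : `[< translation_invariant n Tot_of_TTot >]
}.

HB.instance Definition _ n := [isSub for @Tot_of_TTot n].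
HB.instance Definition _ n := [Choice of TTot n by <:].
HB.instance Definition _ n :=
  [SubChoice_isSubPOrder of TTot n by <: with WO_display].

Lemma le_TotE (r s : Tot) :
  (r <= s)%O <-> inversions r `<=` inversions s.
Proof. by split => [/asboolP|h]; last exact/asboolP. Qed.

Lemma le_TTotE n (r s : TTot n) :
  (r <= s)%O <-> inversions r `<=` inversions s.
Proof. by rewrite -le_TotE Order.le_val. Qed.

(* Main.v *)
Require Import Defs.
From mathcomp Require Import all_boot all_order.
From Stdlib Require Import Relation_Operators.
From mathcomp Require Import ssralg ssrnum ssrint zify.
From mathcomp Require Import boolp classical_sets.

(** The inversion set of a join is the transitive closure of the union of the
    inversion sets, and reversing an order is an anti-automorphism, which gives
    meets.  For semidistributivity, put [w = m \/ y <= z] with [m] the meet of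
    [X], and take an inversion [(a, c)] of [z] that is not one of [w], with
    [c - a] minimal.  Then [z] and [w] agree on smaller intervals, so no [b]
    strictly between [a] and [c] has both [b] before [a] and [c] before [b] in
    [z].  Hence [(a, c)] is an inversion of every [x] in [X], and the integers
    of [[a, c]] split into two blocks, the one of [c] and the one of [a], that
    come in this order in every [x]; so no chain of non-inversions leads from
    [a] to [c], and [(a, c)] is an inversion of [m], a contradiction. *)

Set Implicit Arguments.
Unset Strict Implicit.
Unset Printing Implicit Defensive.

Import Order.TTheory GRing.Theory Num.Theory.

Local Open Scope classical_set_scope.
Local Open Scope ring_scope.

(** * Order duality and transfer to a sublattice *)

Lemma supremums_uniq d (L : porderType d) (X : set L) (s t : L) :
  supremums X s -> supremums X t -> s = t.
Proof.
by move=> [us ls] [ut lt]; apply/le_anti; rewrite ls// lt.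
Qed.

Lemma infimums_uniq d (L : porderType d) (X : set L) (s t : L) :
  infimums X s -> infimums X t -> s = t.
Proof.
by move=> [us ls] [ut lt]; apply/le_anti; rewrite ls// lt.
Qed.

Section AntiAutomorphism.
Variables (d : Order.disp_t) (L : porderType d) (op : L -> L).
Hypotheses (opK : involutive op) (le_op : forall x y, (op x <= op y)%O = (y <= x)%O).

Lemma supremums_op (X : set L) s : supremums (op @` X) (op s) <-> infimums X s.
Proof.
split=> -[us ls]; split.
- by move=> x Xx; rewrite -le_op; apply: us; exists x.
- move=> t lt; rewrite -le_op; apply: ls => _ [x Xx <-].
  by rewrite le_op; exact: lt.
- by move=> _ [x Xx <-]; rewrite le_op; exact: us.
- move=> t ut; rewrite -[t]opK le_op; apply: ls => x Xx.
  by rewrite -le_op opK; apply: ut; exists x.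
Qed.

Lemma infimums_op (X : set L) s : infimums (op @` X) (op s) <-> supremums X s.
Proof.
rewrite -supremums_op opK image_comp.
suff -> : [set (op \o op) x | x in X] = X by [].
by rewrite (_ : op \o op = id) ?image_id//; apply/funext => x /=.
Qed.

(** An order-reversing involution exchanges joins and meets, so the meet law for [X] is the join law
    for its image under [op]. *)
Lemma completely_semidistributive_of_join :
  complete_lattice L ->
  (forall (y z : L) (X : set L), X !=set0 ->
    (forall x, X x -> supremums [set x; y] z) ->
    forall m, infimums X m -> supremums [set m; y] z) ->
  completely_semidistributive L.
Proof.
move=> cL H; split=> // y z X X0; split; first exact: H.
move=> Xyz s Xs; rewrite -supremums_op image_setU !image_set1.
apply: (H _ _ (op @` X)); last exact/infimums_op.
  by case: X0 => x Xx; exists (op x), x.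
by move=> _ [x Xx <-]; have /supremums_op := Xyz _ Xx; rewrite image_setU !image_set1.
Qed.

End AntiAutomorphism.

(** By uniqueness, the suprema and infima of [L] are exactly those computed in [M], so [f]
    transports both laws. *)
Lemma completely_semidistributive_sublattice d d' (L : porderType d)
    (M : porderType d') (f : L -> M) :
  (forall x y, (f x <= f y)%O = (x <= y)%O) ->
  (forall X : set L, exists s, supremums (f @` X) (f s)) ->
  (forall X : set L, exists m, infimums (f @` X) (f m)) ->
  completely_semidistributive M -> completely_semidistributive L.
Proof.
move=> le_f supf inff [_ sdM].
have supI X s : supremums (f @` X) (f s) -> supremums X s.
  move=> [us ls]; split=> [x Xx|t ut]; first by rewrite -le_f; apply: us; exists x.
  by rewrite -le_f; apply: ls => _ [x Xx <-]; rewrite le_f; exact: ut.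
have infI X s : infimums (f @` X) (f s) -> infimums X s.
  move=> [us ls]; split=> [x Xx|t ut]; first by rewrite -le_f; apply: us; exists x.
  by rewrite -le_f; apply: ls => _ [x Xx <-]; rewrite le_f; exact: ut.
have supE X s : supremums X s -> supremums (f @` X) (f s).
  have [t ft] := supf X => Xs.
  by rewrite (supremums_uniq Xs (supI _ _ ft)).
have infE X s : infimums X s -> infimums (f @` X) (f s).
  have [t ft] := inff X => Xs.
  by rewrite (infimums_uniq Xs (infI _ _ ft)).
split=> [X|y z X [x0 Xx0]].
  have [s fs] := supf X; have [m fm] := inff X.
  by split; [exists s; exact: supI|exists m; exact: infI].
have fX0 : f @` X !=set0 by exists (f x0), x0.
have [sd1 sd2] := sdM (f y) (f z) _ fX0.
split=> H m Xm.
- apply: supI; rewrite image_setU !image_set1; apply: sd1 (infE _ _ Xm).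
  by move=> _ [x Xx <-]; have := supE _ _ (H _ Xx); rewrite image_setU !image_set1.
- apply: infI; rewrite image_setU !image_set1; apply: sd2 (supE _ _ Xm).
  by move=> _ [x Xx <-]; have := infE _ _ (H _ Xx); rewrite image_setU !image_set1.
Qed.

(** * Reversal of a total order *)

Section OppositeOrder.
Variable r : Tot.

Let opp_rel : rel int := fun a b => r b a.

Fact opp_irr : irreflexive opp_rel. Proof. by move=> a; exact: prec_irr. Qed.

Fact opp_trans : transitive opp_rel.
Proof. by move=> b a c ba cb; exact: prec_trans cb ba. Qed.

Fact opp_total a b : a != b -> opp_rel a b || opp_rel b a.
Proof. by rewrite orbC; exact: prec_total. Qed.

Definition opposite : Tot := MkTot opp_irr opp_trans opp_total.

End OppositeOrder.

Lemma oppositeK : involutive opposite.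
Proof. by move=> r; exact: Tot_eq. Qed.

(** Reversal complements the inversion set within the pairs [a < b]. *)
Lemma le_opposite (r s : Tot) : (opposite r <= opposite s)%O = (s <= r)%O.
Proof.
have imp (u v : Tot) : (u <= v)%O -> (opposite v <= opposite u)%O.
  move=> /le_TotE uv; apply/le_TotE => -[a b] [/= ab vab]; split=> //=.
  rewrite prec_asym ?lt_eqF//; apply/negP => uba.
  have [_ /=] : inversions v (a, b) by apply: uv.
  by rewrite prec_asym ?gt_eqF// vab.
by apply/idP/idP => /imp //; rewrite !oppositeK.
Qed.

Lemma translation_invariant_opposite n r :
  translation_invariant n r -> translation_invariant n (opposite r).
Proof. by move=> rn a b; exact: rn. Qed.

(** * Reconstruction of a total order from its inversions *)

Section OrderOfInversions.
Variable T : int -> int -> Prop.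
Hypotheses (T_lt : forall a b, T a b -> a < b)
  (T_trans : forall a b c, T a b -> T b c -> T a c)
  (T_cotrans : forall a b c, a < b -> b < c -> T a c -> T a b \/ T b c).

Let inv_rel : rel int := fun a b => `[< (a < b /\ ~ T a b) \/ T b a >].

Fact inv_rel_irr : irreflexive inv_rel.
Proof.
by move=> a; apply/asboolPn => -[[]|/T_lt]; rewrite ltxx.
Qed.

Fact inv_rel_total a b : a != b -> inv_rel a b || inv_rel b a.
Proof.
move=> ab; wlog lab : a b ab / a < b.
  move=> H; have [lab|lba|e] := ltgtP a b; first exact: H.
  - by rewrite orbC H// eq_sym.
  - by rewrite e eqxx in ab.
have [Tab|Tab] := pselect (T a b).
- by apply/orP; right; apply/asboolP; right.
- by apply/orP; left; apply/asboolP; left.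
Qed.

(** [T_trans] and [T_cotrans] make [T] and its complement in [<] transitive, which settles two pairs
    of the same kind. The mixed cases compare [a] with [c] and use one hypothesis for each strict
    outcome. *)
Fact inv_rel_trans : transitive inv_rel.
Proof.
move=> b a c /asboolP[[ab nab]|Tba] /asboolP[[bc nbc]|Tcb]; apply/asboolP.
- left; split; first exact: lt_trans bc.
  by move=> /(T_cotrans ab bc)[].
- have cb := T_lt Tcb; have [ac|ca|e] := ltgtP a c.
  + by left; split=> // Tac; apply: nab; exact: T_trans Tcb.
  + by right; have [|//] := T_cotrans ca ab Tcb.
  + by case: nab; rewrite e.
- have ba := T_lt Tba; have [ac|ca|e] := ltgtP a c.
  + by left; split=> // Tac; apply: nbc; exact: T_trans Tac.
  + by right; have [|] := T_cotrans bc ca Tba.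
  + by case: nbc; rewrite -e.
- by right; exact: T_trans Tba.
Qed.

Definition order_of_inversions : Tot :=
  MkTot inv_rel_irr inv_rel_trans inv_rel_total.

Lemma order_of_inversionsE a b : a < b -> order_of_inversions b a <-> T a b.
Proof.
move=> ab; split=> [/asboolP[[]|//]|Tab]; last by apply/asboolP; right.
by rewrite ltNge (ltW ab).
Qed.

End OrderOfInversions.

(** * Joins as transitive closures *)

Section Join.
Variable X : set Tot.

Definition inv_step (a b : int) : Prop := a < b /\ exists2 x, X x & x b a.

(** The closure grows by steps at the upper end, the end that the inductions below peel off. *)
Definition inv_chain : int -> int -> Prop := clos_trans_n1 int inv_step.

Lemma inv_chain_lt a b : inv_chain a b -> a < b.
Proof. by elim=> [c []//|c d [cd _] _ ac]; exact: lt_trans cd. Qed.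

Lemma inv_chain_trans a b c : inv_chain a b -> inv_chain b c -> inv_chain a c.
Proof.
move=> ab; elim=> [d bd|d e de _ ad]; first exact: tn1_trans ab.
exact: tn1_trans ad.
Qed.

Lemma inv_step_cotrans a b c : a < b -> b < c ->
  inv_step a c -> inv_step a b \/ inv_step b c.
Proof.
move=> ab bc [_ [x Xx xca]]; have [xba|xba] := boolP (x b a).
  by left; split=> //; exists x.
right; split=> //; exists x => //; apply: prec_trans xca _.
by rewrite prec_asym ?lt_eqF.
Qed.

(** Induction on the chain: [b] lies before the last step, at its start, or inside it, where
    [inv_step_cotrans] splits the step. *)
Lemma inv_chain_cotrans a b c : a < b -> b < c ->
  inv_chain a c -> inv_chain a b \/ inv_chain b c.
Proof.
move=> ab bc ac; elim: ac bc => [d ad bd|d e de ad IH be].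
  by have [|] := inv_step_cotrans ab bd ad; [left|right]; exact: tn1_step.
have [bd|db|->] := ltgtP b d; last by left.
- by have [|bd'] := IH bd; [left|right; exact: tn1_trans bd'].
- have [db'|be'] := inv_step_cotrans db be de; last by right; exact: tn1_step.
  by left; exact: tn1_trans ad.
Qed.

Definition join : Tot :=
  order_of_inversions inv_chain_lt inv_chain_trans inv_chain_cotrans.

Lemma joinE a b : a < b -> join b a <-> inv_chain a b.
Proof. exact: order_of_inversionsE. Qed.

Lemma inv_chain_last a c : inv_chain a c ->
  inv_step a c \/ exists2 b, inv_chain a b & inv_chain b c.
Proof. by case=> [d|d e de ad]; [left|right; exists d => //; exact: tn1_step]. Qed.

Lemma inv_chain_ubound s a b : ubound X s -> inv_chain a b -> s b a.
Proof.
move=> us; have step c d : inv_step c d -> s d c.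
  move=> [cd [x Xx xdc]].
  by have /le_TotE/(_ (c, d))[] := us x Xx.
by elim=> [c /step//|c d /step dc _]; exact: prec_trans.
Qed.

Lemma supremums_join : supremums X join.
Proof.
split=> [x Xx|s us]; apply/le_TotE => -[a b] [/= ab].
- move=> xba; split=> //=; apply: (proj2 (joinE ab)).
  by apply: tn1_step; split=> //; exists x.
- by move=> /(proj1 (joinE ab)) jba; split=> //=; exact: inv_chain_ubound.
Qed.

Lemma inv_chain_supremums s a b :
  supremums X s -> a < b -> s b a -> inv_chain a b.
Proof.
by move=> /supremums_uniq/(_ supremums_join) -> ab /(proj1 (joinE ab)).
Qed.

Lemma join_translation_invariant n :
  (forall x, X x -> translation_invariant n x) -> translation_invariant n join.
Proof.
move=> Xn.
have step a b : inv_step a b <-> inv_step (a + n%:Z) (b + n%:Z).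
  rewrite /inv_step ltrD2r; split=> -[ab [x Xx xba]]; split=> //; exists x => //.
    exact: (proj1 (Xn x Xx _ _)) xba.
  exact: (proj2 (Xn x Xx _ _)) xba.
have chain a b : inv_chain a b <-> inv_chain (a + n%:Z) (b + n%:Z).
  split=> [|ab].
    elim=> [c ac|c d cd _ ac]; first by apply/tn1_step/(proj1 (step _ _)).
    by apply: tn1_trans ac; apply/(proj1 (step _ _)).
  (* Writing [b] as [b + n - n] lets the induction generalize the endpoint [b + n]. *)
  rewrite -[b](addrK n%:Z); elim: ab => [c ac|c d cd _ ac].
    by apply: tn1_step; apply/step; rewrite subrK.
  by apply: tn1_trans ac; apply/step; rewrite !subrK.
move=> a b; split=> /asboolP H; apply/asboolP; move: H;
  by rewrite ltrD2r -!chain.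
Qed.

End Join.

(** * Meets by duality *)

Definition meet (X : set Tot) : Tot := opposite (join (opposite @` X)).

Lemma infimums_meet X : infimums X (meet X).
Proof.
apply/(supremums_op oppositeK le_opposite).
by rewrite oppositeK; exact: supremums_join.
Qed.

Lemma Tot_complete : complete_lattice Tot.
Proof.
by move=> X; split; [exists (join X); exact: supremums_join
                    |exists (meet X); exact: infimums_meet].
Qed.

(** A step for the reversed orders is a pair [a < b] that some member of [X] does not invert, so
    each non-inversion of the meet is a chain of such pairs. *)
Lemma inv_chain_infimums (X : set Tot) m a b :
  infimums X m -> a < b -> m a b -> inv_chain (opposite @` X) a b.
Proof.
move=> /(supremums_op oppositeK le_opposite) Xm ab mab.
exact: inv_chain_supremums Xm ab mab.
Qed.

(** * Join semidistributivity of [Tot] *)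

Lemma Tot_join_semidistributive (y z : Tot) (X : set Tot) : X !=set0 ->
  (forall x, X x -> supremums [set x; y] z) ->
  forall m, infimums X m -> supremums [set m; y] z.
Proof.
move=> [x0 Xx0] Xyz m Xm.
have [uw lw] := supremums_join [set m; y]; set w := join _ in uw lw.
have leE (u v : Tot) a b : (u <= v)%O -> a < b -> u b a -> v b a.
  by move=> /le_TotE uv ab uba; have [] := uv (a, b).
have mw : (m <= w)%O by apply: uw; left.
have yw : (y <= w)%O by apply: uw; right.
have yz : (y <= z)%O by have [+ _] := Xyz _ Xx0; apply; right.
have xz x : X x -> (x <= z)%O by move=> Xx; have [+ _] := Xyz _ Xx; apply; left.
have mz : (m <= z)%O.
  by apply: le_trans (xz _ Xx0); have [+ _] := Xm; apply.
suff zw : (z <= w)%O.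
  split=> [_ [->|->]//|v uv]; apply: le_trans zw _; exact: lw.
(* Induction on the bound [k] for the length plays the role of a minimal counterexample. *)
suff key k a c : a < c -> c - a < k%:Z -> z c a -> w c a.
  apply/le_TotE => -[a c] [/= ac zca]; split=> //=.
  by apply: (key `|c - a|.+1) => //; lia.
elim: k a c => [|k IH] a c ac ack zca; first by lia.
apply/negPn/negP => nwca.
have nsplit b : a < b -> b < c -> z b a -> z c b -> False.
  move=> ab bc zba zcb; move/negP: nwca; apply.
  by apply: (@prec_trans w b); apply: IH => //; lia.
have xca x : X x -> x c a.
  move=> Xx; have [zub _] := Xyz _ Xx.
  (* A longer chain would pass through some [b] excluded by [nsplit]; a single step coming from [y]
     would be an inversion of [w]. *)
  have : inv_step [set x; y] a c.
    have [//|[b ab bc]] := inv_chain_last (inv_chain_supremums (Xyz _ Xx) ac zca).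
    have [lab lbc] := (inv_chain_lt ab, inv_chain_lt bc).
    by case: (nsplit b lab lbc); apply: inv_chain_ubound zub _.
  move=> [_ [u [->//|-> yca]]].
  by case/negP: nwca; exact: leE yca.
(* [a] and the [d] with [a] before [d] in [z] form a block closed under the
   steps of [inv_chain (opposite @` X)] inside [[a, c]]. *)
have block d : inv_chain (opposite @` X) a d -> d <= c ->
    d < c /\ (d = a \/ z a d).
  have xblock x b : X x -> a < b -> z a b -> x a b.
    move=> Xx ab zab; rewrite prec_asym ?lt_eqF//.
    apply/negP => /(leE _ _ _ _ (xz _ Xx) ab); apply/negP.
    by rewrite -prec_asym ?lt_eqF.
  have step b d' : a <= b -> b = a \/ z a b -> inv_step (opposite @` X) b d' ->
      d' <= c -> d' < c /\ (d' = a \/ z a d').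
    move=> leab zab [bd [_ [x Xx <-] /= xbd]] dc.
    have xad : x a d'.
      case: zab => [<-//|zab]; apply: prec_trans xbd; apply: xblock => //.
      by rewrite lt_neqAle leab andbT; apply/eqP => e; move: zab; rewrite e prec_irr.
    have ad : a < d' := le_lt_trans leab bd.
    have dc' : d' < c.
      rewrite lt_neqAle dc andbT; apply/eqP => e; move: xad.
      by rewrite e prec_asym ?lt_eqF// xca.
    (* If [d'] came before [a] in [z], then [nsplit] would keep [(d', c)] from being inverted in
       [z], hence in [x]; with [x c a] this puts [d'] before [a] in [x], against [xad]. *)
    split=> //; right; rewrite prec_asym ?lt_eqF//; apply/negP => zda.
    have : x d' a.
      apply: prec_trans (xca _ Xx); rewrite prec_asym ?lt_eqF//.
      apply/negP => /(leE _ _ _ _ (xz _ Xx) dc').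
      exact: nsplit zda.
    by apply/negP; rewrite -prec_asym ?lt_eqF.
  elim=> [e ae|b e be ab IHb] ec; first by apply: step ae ec => //; left.
  have lbe : b < e by case: be.
  have [_ zab] := IHb (le_trans (ltW lbe) ec).
  by apply: step be ec => //; exact/ltW/(inv_chain_lt ab).
(* This non-inversion of [m] yields a chain from [a] to [c], for which [block] gives [c < c]. *)
have mac : m a c.
  rewrite prec_asym ?lt_eqF//; apply/negP => mca.
  by case/negP: nwca; exact: leE mca.
have [] := block _ (inv_chain_infimums Xm ac mac) (lexx c).
by rewrite ltxx.
Qed.

Theorem theorem5p17 (n : nat) (n_gt0 : (0 < n)%N) :
  completely_semidistributive Tot /\ completely_semidistributive (TTot n).
Proof.
have sdTot : completely_semidistributive Tot.
  exact: completely_semidistributive_of_join oppositeK le_opposite Tot_complete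
    Tot_join_semidistributive.
split=> //.
have TTotP (x : TTot n) : translation_invariant n x by exact/asboolP/(valP x).
(* Joins and meets taken in [Tot] preserve translation invariance, so [TTot n] is a complete
   sublattice. *)
apply: (completely_semidistributive_sublattice (f := @Tot_of_TTot n)) sdTot.
- by move=> x y; rewrite -Order.le_val.
- move=> X.
  have jn : translation_invariant n (join (@Tot_of_TTot n @` X)).
    by apply: join_translation_invariant => _ [x _ <-].
  by exists (MkTTot (asboolT jn)); exact: supremums_join.
- move=> X.
  have mn : translation_invariant n (meet (@Tot_of_TTot n @` X)).
    apply/translation_invariant_opposite/join_translation_invariant.
    by move=> _ [_ [x _ <-] <-]; exact: translation_invariant_opposite.
  by exists (MkTTot (asboolT mn)); exact: infimums_meet.
Qed.
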